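(* Let $(M,g)$ be a Riemannian manifold and let $g_A$ be the metric on $T(M)$ determined by smooth functions $a,b:[0,+\infty)\to[0,+\infty)$ with $a>0$, as described in the context. Let $G_A$ be the metric induced by $g_A$ on $T_1M$, and write $a$ also for the positive constant $a(\frac12)$. For $r>0$ let $G_r$ be the metric induced on $T_rM$ by the Sasaki metric $g_S$. Then the Riemannian manifolds $(T_1M,G_A)$ and $(T_rM,G_r)$ are isometric for $r=\sqrt a$.
   Context: For $r>0$, $T_rM=\{v\in T(M): g(v,v)=r^2\}$. For $(p,\mathtt{u})\in T(M)$ put $t=\frac12g_p(\mathtt{u},\mathtt{u})$ (so $t=\frac12$ on $T_1M$); $X^H,X^V$ are the horizontal (with respect to the Levi-Civita connection of $g$) and vertical lifts. The metrics on $T(M)$ are $$g_A(X^H,Y^H)=g(X,Y),\quad g_A(X^H,Y^V)=0,\quad g_A(X^V,Y^V)=a(t)g(X,Y)+b(t)g(X,\mathtt{u})g(Y,\mathtt{u}),$$ and $g_S$ is the case $a\equiv1$, $b\equiv0$. In local coordinates $(x^i,y^i)$ on $T(M)$, $G_A(\delta_i,\delta_j)=g_{ij}$, $G_A(\delta_i,Y_j)=0$, $G_A(Y_i,Y_j)=a(g_{ij}-g_{i0}g_{j0})$, where $\delta_i=\frac{\partial}{\partial x^i}-\Gamma_{ij}^ky^j\frac{\partial}{\partial y^k}$, $Y_i=\frac{\partial}{\partial y^i}-g_{i0}y^h\frac{\partial}{\partial y^h}$, $g_{i0}=g_{ij}y^j$. *)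

(* Defs.v *)
From HB Require Import structures.
From mathcomp Require Import all_boot all_order all_algebra.
From mathcomp Require Import all_classical all_reals all_analysis.
From mathcomp Require Import ring lra.

Set Implicit Arguments.
Unset Strict Implicit.
Unset Printing Implicit Defensive.

Import Order.TTheory GRing.Theory Num.Theory.
Import numFieldNormedType.Exports.

Local Open Scope classical_set_scope.
Local Open Scope ring_scope.

Fixpoint Ck (R : realType) (V W : normedModType R) (k : nat) (U : set V)
    (f : V -> W) : Prop :=
  if k is k'.+1 then
    (forall x, U x -> differentiable f x) /\
    (forall v : V, Ck k' U (fun x => 'D_v f x))
  else forall x, U x -> {for x, continuous f}.

(* Only used for open [U]. *)
Definition smooth (R : realType) (V W : normedModType R) (U : set V)
    (f : V -> W) : Prop :=
  forall k, Ck k U f.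

(* Smoothness on the closed half-line [0, +oo[, boundary point included. *)
Definition smooth_half_line (R : realType) (f : R -> R) : Prop :=
  exists f' : R -> R, smooth setT f' /\ forall t, 0 <= t -> f t = f' t.

(* A manifold is a set [X] with an atlas, which also determines the topology of
   [X] (see [mopen]): no topology on [X] is given beforehand.  The atlas comes
   with a preferred chart [chart_at p] around each point [p], and a tangent
   vector at [p] is represented by its components in that chart.  So every
   tangent space of an [m]-dimensional manifold is the type ['rV_m], but
   components at different points refer to different charts, and [m]-tuples at
   distinct points cannot be compared without [tcoord] below. *)

Record atlas (R : realType) (m : nat) (X : Type) := Atlas {
  chart_idx : Type;
  dom : chart_idx -> set X;
  chart : chart_idx -> X -> 'rV[R]_m;
  param : chart_idx -> 'rV[R]_m -> X; (* inverse of the chart on its domain *)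
  chart_at : X -> chart_idx }.

Section Manifold.
Variables (R : realType) (m : nat) (X : Type) (A : atlas R m X).

Definition mopen (W : set X) : Prop :=
  forall i, open (chart (a := A) i @` (W `&` dom i)).

Record is_manifold : Prop := IsManifold {
  dom_chart_at : forall p, dom (chart_at A p) p;
  chartK : forall (i : chart_idx A) p, dom i p -> param i (chart i p) = p;
  mopen_dom : forall i : chart_idx A, mopen (dom i);
  smooth_transition : forall i j : chart_idx A,
    smooth (chart i @` (dom i `&` dom j)) (chart j \o param i);
  manifold_hausdorff : forall p q : X, p <> q ->
    exists U V, [/\ mopen U, mopen V, U p, V q & U `&` V = set0];
  manifold_second_countable : exists B : nat -> set X,
    (forall k, mopen (B k)) /\
    (forall W p, mopen W -> W p -> exists k, B k p /\ B k `<=` W) }.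

(* Components in the chart [i] of the vector [u] tangent at [p]. *)
Definition tcoord (i : chart_idx A) (p : X) (u : 'rV[R]_m) : 'rV[R]_m :=
  'd (chart i \o param (chart_at A p)) (chart (chart_at A p) p) u.

(* The vector tangent at [param i x] with components [y] in the chart [i]. *)
Definition tvect (i : chart_idx A) (x y : 'rV[R]_m) : 'rV[R]_m :=
  'd (chart (chart_at A (param i x)) \o param i) x y.

(* The curve [c], defined near the parameter 0, lies in [S], is smooth and
   passes through [x] at 0. *)
Definition curve_in (S : set X) (x : X) (c : R -> X) : Prop :=
  c 0 = x /\
  exists2 e : R, 0 < e &
    (forall s, `|s| < e -> S (c s) /\ dom (chart_at A x) (c s)) /\
    smooth [set s | `|s| < e] (chart (chart_at A x) \o c).

Definition velocity (c : R -> X) : 'rV[R]_m :=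
  derive1 (chart (chart_at A (c 0)) \o c) 0.

(* A field of bilinear forms on the tangent spaces. *)
Definition tensor2 := X -> 'rV[R]_m -> 'rV[R]_m -> R.

Definition is_inner_product (h : 'rV[R]_m -> 'rV[R]_m -> R) : Prop :=
  [/\ forall (k : R) u v w, h (k *: u + v) w = k * h u w + h v w,
      forall u v, h u v = h v u &
      forall u, u != 0 -> 0 < h u u].

(* Components of [g] at the point with coordinates [x] in the chart [i]. *)
Definition gmat (g : tensor2) (i : chart_idx A) (x : 'rV[R]_m) : 'M[R]_m :=
  \matrix_(k, l) g (param i x) (tvect i x (delta_mx 0 k))
                               (tvect i x (delta_mx 0 l)).

Definition is_riemannian_metric (g : tensor2) : Prop :=
  (forall p, is_inner_product (g p)) /\
  (forall (i : chart_idx A) k l,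
     smooth (chart i @` dom i) (fun x => gmat g i x k l)).

(* [partial_gmat g i x j k l] is the derivative of [g_kl] along [x^j]. *)
Definition partial_gmat (g : tensor2) (i : chart_idx A) (x : 'rV[R]_m)
    (j k l : 'I_m) : R :=
  'D_(delta_mx 0 j) (fun x' => gmat g i x' k l) x.

(* [christoffel g i x k j l] is Gamma^k_(jl), a coefficient in the chart [i] of
   the Levi-Civita connection; see [christoffelP]. *)
Definition christoffel (g : tensor2) (i : chart_idx A) (x : 'rV[R]_m)
    (k j l : 'I_m) : R :=
  2^-1 * \sum_(s < m) invmx (gmat g i x) k s *
    (partial_gmat g i x j l s + partial_gmat g i x l j s
     - partial_gmat g i x s j l).

(* The connection with coefficients [G] is torsion-free and metric at [x]. *)
Definition is_levi_civita_at (g : tensor2) (i : chart_idx A) (x : 'rV[R]_m)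
    (G : 'I_m -> 'I_m -> 'I_m -> R) : Prop :=
  (forall k j l, G k j l = G k l j) /\
  (forall j k l, partial_gmat g i x j k l =
     \sum_(s < m) (G s j k * gmat g i x s l + G s j l * gmat g i x k s)).

End Manifold.

Lemma tcoord_tvect (R : realType) (m : nat) (X : Type) (A : atlas R m X)
    (i : chart_idx A) (p : X) (y : 'rV[R]_m) :
  is_manifold A -> dom i p -> tcoord i p (tvect i (chart i p) y) = y.
Proof.
move=> mA ip; rewrite /tcoord /tvect (chartK mA) //.
set j := chart_at A p; have jp : dom j p := dom_chart_at mA p.
pose D := chart i @` (dom i `&` dom j).
have oD : open D by rewrite /D setIC; exact: mopen_dom mA j i.
have Dp : D (chart i p) by exists p.
have dij : differentiable (chart j \o param i) (chart i p).
  by have [+ _] := smooth_transition mA i j 1%N; apply.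
have e : (chart j \o param i) (chart i p) = chart j p.
  by rewrite /= (chartK mA).
have dji : differentiable (chart i \o param j) (chart j p).
  have [+ _] := smooth_transition mA j i 1%N; apply.
  by exists p.
rewrite -e in dji *.
have dc : differentiable ((chart i \o param j) \o (chart j \o param i))
  (chart i p) by exact: differentiable_comp.
rewrite -[LHS](congr1 (fun f => f y) (diff_comp dij dji)) -deriveE //.
apply: (etrans _ (derive_id (chart i p) y)); apply: near_eq_derive.
have : nbhs (chart i p) D by exact: open_nbhs_nbhs.
apply: filterS => _ [q [iq jq] <-] /=.
by rewrite !(chartK mA).
Qed.

Lemma gmat_unit (R : realType) (m : nat) (X : Type) (A : atlas R m X)
    (g : tensor2 R m X) (i : chart_idx A) (p : X) :
  is_manifold A -> is_riemannian_metric A g -> dom i p ->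
  gmat g i (chart i p) \in unitmx.
Proof.
move=> mA [gi _] ip; rewrite -row_free_unit; apply: inj_row_free => y vG.
have pE : param i (chart i p) = p := chartK mA ip.
have [gl gs gp] := gi p.
have gD u v w : g p (u + v) w = g p u w + g p v w.
  by have := gl 1 u v w; rewrite scale1r mul1r.
have g0 w : g p 0 w = 0 by apply: (addrI (g p 0 w)); rewrite -gD !addr0.
have gZ k u w : g p (k *: u) w = k * g p u w.
  by have := gl k u 0 w; rewrite addr0 g0 addr0.
have gS (u : 'I_m -> 'rV[R]_m) w :
    g p (\sum_k u k) w = \sum_k g p (u k) w.
  by elim/big_rec2: _ => // k s t _ <-.
pose T := tvect i (chart i p).
have TE u : T u = \sum_k u 0 k *: T (delta_mx 0 k).
  rewrite [in LHS](row_sum_delta u) /T /tvect linear_sum.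
  by apply: eq_bigr => k _; rewrite linearZ.
have gv : g p (T y) (T y) = 0.
  rewrite [X in g p _ X]TE gs gS; apply: big1 => l _; rewrite gZ gs.
  have := congr1 (fun M : 'rV[R]_m => M 0 l) vG; rewrite !mxE => e.
  rewrite TE gS; rewrite [X in _ * X](_ : _ = 0) ?mulr0 // -[RHS]e.
  by apply: eq_bigr => k _; rewrite gZ mxE pE.
have [T0|Tn0] := eqVneq (T y) 0; last by have := gp _ Tn0; rewrite gv ltxx.
by rewrite -(tcoord_tvect y mA ip) -/T -/(T y) T0 /tcoord linear0.
Qed.

Lemma christoffelP (R : realType) (m : nat) (X : Type) (A : atlas R m X)
    (g : tensor2 R m X) (i : chart_idx A) (p : X)
    (G : 'I_m -> 'I_m -> 'I_m -> R) (x := chart i p) :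
  is_manifold A -> is_riemannian_metric A g -> dom i p ->
  is_levi_civita_at g i x G <->
  (forall k j l, G k j l = christoffel g i x k j l).
Proof.
move=> mA gA ip; have gU : gmat g i x \in unitmx by exact: gmat_unit.
have gsym q u v : g q u v = g q v u by have [/(_ q)[]] := gA.
have gmsym x' k l : gmat g i x' k l = gmat g i x' l k.
  by rewrite !mxE gsym.
have dsym j k l : partial_gmat g i x j k l = partial_gmat g i x j l k.
  by rewrite /partial_gmat; congr ('D_ _ _ _); apply/funext => x'.
pose C s j l := 2^-1 * (partial_gmat g i x j l s + partial_gmat g i x l j s
     - partial_gmat g i x s j l).
have chrE k j l : christoffel g i x k j l =
    \sum_(s < m) invmx (gmat g i x) k s * C s j l.
  by rewrite /christoffel mulr_sumr; apply: eq_bigr => s _; rewrite /C; ring.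
have lower k j l : \sum_(s < m) gmat g i x k s * christoffel g i x s j l
    = C k j l.
  under eq_bigr do rewrite chrE.
  have -> : C k j l = ((gmat g i x *m invmx (gmat g i x))
      *m (\col_t C t j l)) k 0 by rewrite mulmxV // mul1mx mxE.
  rewrite -mulmxA !mxE; apply: eq_bigr => s _; rewrite !mxE; congr (_ * _).
  by apply: eq_bigr => t _; rewrite !mxE.
split=> [[Gs Gm] k j l|GE].
  pose L s j l := \sum_(t < m) G t j l * gmat g i x t s.
  have Gm' a b c : partial_gmat g i x a b c = L c a b + L b a c.
    rewrite Gm big_split /=; congr (_ + _).
    by apply: eq_bigr => s _; rewrite gmsym.
  have Ls s a b : L s a b = L s b a by apply: eq_bigr => t _; rewrite Gs.
  have LC s : C s j l = L s j l.
    by rewrite /C !Gm' (Ls s l j) (Ls l j s) (Ls j l s); field.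
  rewrite chrE; under eq_bigr do rewrite LC.
  have -> : G k j l = (invmx (gmat g i x) *m
      (gmat g i x *m (\col_t G t j l))) k 0.
    by rewrite mulmxA mulVmx // mul1mx mxE.
  rewrite !mxE; apply: eq_bigr => s _; congr (_ * _).
  by rewrite mxE; apply: eq_bigr => t _; rewrite [X in _ * X]mxE gmsym mulrC.
split=> [k j l|j k l].
  rewrite !GE !chrE; apply: eq_bigr => s _; congr (_ * _).
  by rewrite /C (dsym s l j); ring.
rewrite big_split /=.
have -> : \sum_(s < m) G s j k * gmat g i x s l = C l j k.
  by rewrite -lower; apply: eq_bigr => s _; rewrite GE gmsym mulrC.
have -> : \sum_(s < m) G s j l * gmat g i x k s = C k j l.
  by rewrite -lower; apply: eq_bigr => s _; rewrite GE mulrC.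
by rewrite /C (dsym j l k) (dsym l j k) (dsym k j l) (dsym l k j); field.
Qed.

Section Maps.
Variables (R : realType) (m m' : nat) (X X' : Type).
Variables (A : atlas R m X) (A' : atlas R m' X').

(* [f] is smooth on a neighbourhood of [x]. *)
Definition smooth_near (f : X -> X') (x : X) : Prop :=
  let i := chart_at A x in let j := chart_at A' (f x) in
  exists U : set 'rV[R]_m,
    [/\ open U, U (chart i x), U `<=` chart i @` dom i,
        (forall w, U w -> dom j (f (param i w))) &
        smooth U (chart j \o f \o param i)].

(* Smoothness of a map whose source is the submanifold [S]: local extensions to
   the ambient manifold are smooth. *)
Definition smooth_on (S : set X) (f : X -> X') : Prop :=
  forall x, S x -> exists (W : set X) (F : X -> X'),
    [/\ mopen A W, W x, (forall y, W y -> S y -> F y = f y) &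
        smooth_near F x].

End Maps.

(* [f] is an isometry from the submanifold [S] of [X] with the metric induced by
   [h] onto the submanifold [S'] of [X'] with the metric induced by [h'].  The
   tangent vectors of [S] at [x] are the velocities of the curves in [S] through
   [x], and the differential of [f] maps the velocity of [c] to that of
   [f \o c]. *)
Definition is_isometry (R : realType) (m m' : nat) (X X' : Type)
    (A : atlas R m X) (S : set X) (h : tensor2 R m X)
    (A' : atlas R m' X') (S' : set X') (h' : tensor2 R m' X')
    (f : X -> X') : Prop :=
  [/\ set_bij S S' f,
      smooth_on A A' S f,
      (exists2 f' : X' -> X, (forall x, S x -> f' (f x) = x) &
         smooth_on A' A S' f') &
      forall x c1 c2, S x -> curve_in A S x c1 -> curve_in A S x c2 ->
        h' (f x) (velocity A' (f \o c1)) (velocity A' (f \o c2)) =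
        h x (velocity A c1) (velocity A c2)].

Definition isometric (R : realType) (m m' : nat) (X X' : Type)
    (A : atlas R m X) (S : set X) (h : tensor2 R m X)
    (A' : atlas R m' X') (S' : set X') (h' : tensor2 R m' X') : Prop :=
  exists f : X -> X', is_isometry A S h A' S' h' f.

Section TangentBundle.
Variables (R : realType) (n : nat) (X : Type) (M : atlas R n X).

(* The chart [i] of [M] induces the coordinates [(x^1..x^n, y^1..y^n)] on the
   set [X * 'rV_n] of all pairs (p, u) with [u] tangent at [p].  This atlas does
   not in general give the product topology. *)
Definition tangent_atlas : atlas R (n + n) (X * 'rV[R]_n) := {|
  chart_idx := chart_idx M;
  dom := fun i => [set z | dom i z.1];
  chart := fun i z => row_mx (chart i z.1) (tcoord i z.1 z.2);
  param := fun i w => (param i (lsubmx w), tvect i (lsubmx w) (rsubmx w));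
  chart_at := fun z => chart_at M z.1 |}.

Variable g : tensor2 R n X.

Definition sphere_bundle (r : R) : set (X * 'rV[R]_n) :=
  [set z | g z.1 z.2 z.2 = r ^+ 2].

(* Tangent vectors at [z = (p, u)] have components [row_mx xi eta] in the
   coordinates [(x, y)] induced by the preferred chart at [p], in which [u] is
   its own [y]-coordinate.  [gamma z Y] is the vector with components
   [Gamma^k_(jl) Y^j u^l]. *)
Definition gamma (z : X * 'rV[R]_n) (Y : 'rV[R]_n) : 'rV[R]_n :=
  let i := chart_at M z.1 in
  \row_k \sum_(j < n) \sum_(l < n)
    christoffel g i (chart i z.1) k j l * Y 0 j * z.2 0 l.

Definition hlift (z : X * 'rV[R]_n) (Y : 'rV[R]_n) : 'rV[R]_(n + n) :=
  row_mx Y (- gamma z Y).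

Definition vlift (z : X * 'rV[R]_n) (Y : 'rV[R]_n) : 'rV[R]_(n + n) :=
  row_mx 0 Y.

(* The vectors at [p] whose horizontal, resp. vertical, lifts sum to [w]. *)
Definition hpart (z : X * 'rV[R]_n) (w : 'rV[R]_(n + n)) : 'rV[R]_n :=
  lsubmx w.

Definition vpart (z : X * 'rV[R]_n) (w : 'rV[R]_(n + n)) : 'rV[R]_n :=
  rsubmx w + gamma z (lsubmx w).

Lemma lift_decomposition z w : w = hlift z (hpart z w) + vlift z (vpart z w).
Proof.
by rewrite /hlift /vlift add_row_mx addr0 addrCA addNr addr0 hsubmxK.
Qed.

Definition metricA (a b : R -> R) : tensor2 R (n + n) (X * 'rV[R]_n) :=
  fun z w w' =>
  let t := 2^-1 * g z.1 z.2 z.2 in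
  g z.1 (hpart z w) (hpart z w') +
  (a t * g z.1 (vpart z w) (vpart z w') +
   b t * g z.1 (vpart z w) z.2 * g z.1 (vpart z w') z.2).

Definition metricS : tensor2 R (n + n) (X * 'rV[R]_n) :=
  metricA (fun=> 1) (fun=> 0).

Lemma hpart_hlift z Y : hpart z (hlift z Y) = Y.
Proof. exact: row_mxKl. Qed.

Lemma vpart_hlift z Y : vpart z (hlift z Y) = 0.
Proof. by rewrite /vpart row_mxKr row_mxKl addNr. Qed.

Lemma hpart_vlift z Y : hpart z (vlift z Y) = 0.
Proof. exact: row_mxKl. Qed.

Lemma vpart_vlift z Y : vpart z (vlift z Y) = Y.
Proof.
rewrite /vpart row_mxKr row_mxKl [gamma _ _](_ : _ = 0) ?addr0 //.
apply/rowP => k; rewrite !mxE big1 // => j _; rewrite big1 // => l _.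
by rewrite mxE mulr0 mul0r.
Qed.

Hypothesis g_inner : forall p, is_inner_product (g p).

Let g0l p v : g p 0 v = 0.
Proof.
have [gD _ _] := g_inner p; have := gD 0 0 0 v.
by rewrite scaler0 addr0 mul0r add0r => gE; have := gD 1 0 0 v;
   rewrite scaler0 addr0; lra.
Qed.

Let g0r p v : g p v 0 = 0.
Proof. by have [_ gC _] := g_inner p; rewrite gC g0l. Qed.

Lemma metricA_hh a b z Y Z :
  metricA a b z (hlift z Y) (hlift z Z) = g z.1 Y Z.
Proof. by rewrite /metricA !hpart_hlift !vpart_hlift !g0l !mulr0 !addr0. Qed.

Lemma metricA_hv a b z Y Z : metricA a b z (hlift z Y) (vlift z Z) = 0.
Proof.
rewrite /metricA hpart_hlift vpart_hlift hpart_vlift vpart_vlift.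
by rewrite !g0l g0r !mulr0 mul0r !addr0.
Qed.

Lemma metricA_vv a b z Y Z (t := 2^-1 * g z.1 z.2 z.2) :
  metricA a b z (vlift z Y) (vlift z Z) =
  a t * g z.1 Y Z + b t * g z.1 Y z.2 * g z.1 Z z.2.
Proof. by rewrite /metricA !hpart_vlift !vpart_vlift g0l add0r. Qed.

End TangentBundle.

(* Main.v *)
Require Import Defs.
From mathcomp Require Import all_boot all_order all_algebra.
From mathcomp Require Import all_classical all_reals all_analysis.
From mathcomp Require Import ring.
Set Implicit Arguments.
Unset Strict Implicit.
Unset Printing Implicit Defensive.
Import Order.TTheory GRing.Theory Num.Theory.
Import numFieldNormedType.Exports.
Local Open Scope classical_set_scope.
Local Open Scope ring_scope.

(** The isometry is the fibrewise homothety (p, u) |-> (p, r u), with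
    r = sqrt a.

    In the induced coordinates of TM it reads (x, y) |-> (x, r y), a linear map;
    hence it is smooth, as is its inverse, the homothety of ratio 1 / r, and its
    differential is given by the same formula ([velocity_fiber_scale]).  As the
    Christoffel term of the vertical part is linear in u, the differential keeps
    the horizontal part of a tangent vector and multiplies the vertical part V
    by r ([vpart_fiber_scale]).  The Sasaki metric of the images is therefore
    g(H, H') + r^2 g(V, V').

    On the unit sphere bundle t = 1/2, so g_A of the original vectors is
    g(H, H') + a g(V, V') + b g(V, u) g(V', u) with a = r^2, and the two agree
    once the term in b vanishes.  It does because the vertical part of a vector
    tangent to a sphere bundle is orthogonal to u ([sphere_bundle_orth]):
    along a curve (x(s), y(s)) in the bundle g_kl(x) y^k y^l is constant, and,
    the Levi-Civita connection being metric, its derivative is 2 g(V, u). *)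

(** * Differentiability and smoothness *)

Lemma near_eq_differentiable (R : realType) (V W : normedModType R)
    (f h : V -> W) (x : V) :
  (\near x, f x = h x) -> differentiable f x -> differentiable h x.
Proof.
move=> fh df.
suff d0 : differentiable (h - f) x.
  by rewrite -(subrK f h); exact: differentiableD.
(* [h - f] vanishes near [x], so its differential there is 0. *)
have e : (h - f) \o shift x = cst ((h - f) x) + \0 +o_ (0 : V) id.
  apply/eqaddoP => eps eps0.
  have fhx : f x = h x := nbhs_singleton fh.
  have fh0 := (nbhs0P _ _).1 fh; apply: filterS fh0 => y; rewrite addrC => fhy.
  rewrite -[X in `|X|]/(h (y + x) - f (y + x) - (h x - f x + 0)).
  by rewrite fhx fhy !subrr addr0 subr0 normr0 mulr_ge0 ?normr_ge0 ?(ltW eps0).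
have c0 : continuous (\0 : V -> W) by exact: cst_continuous.
by apply/diff_locallyP; rewrite (diff_unique c0 e); split.
Qed.

(** [U] has to be open for the derivatives of [f] and [h] to agree on it. *)
Lemma Ck_eq (R : realType) (V W : normedModType R) (k : nat) (U : set V)
    (f h : V -> W) :
  open U -> (forall x, U x -> f x = h x) -> Ck k U f -> Ck k U h.
Proof.
move=> oU; elim: k f h => [|k IHk] f h fh.
  move=> cf x Ux; rewrite /prop_for /continuous_at -(fh _ Ux).
  apply: cvg_trans (cf x Ux); apply: near_eq_cvg.
  by apply: filterS (open_nbhs_nbhs (conj oU Ux)) => y /fh.
have near_fh x : U x -> \near x, f x = h x.
  by move=> Ux; apply: filterS (open_nbhs_nbhs (conj oU Ux)) => y /fh.
move=> [df Df]; split=> [x Ux|v].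
  exact: near_eq_differentiable (near_fh _ Ux) (df _ Ux).
by apply: IHk (Df v) => x /near_fh; exact: near_eq_derive.
Qed.

Lemma smooth_eq (R : realType) (V W : normedModType R) (U : set V)
    (f h : V -> W) :
  open U -> (forall x, U x -> f x = h x) -> smooth U f -> smooth U h.
Proof. by move=> oU fh sf k; exact: Ck_eq (sf k). Qed.

Lemma Ck_cst (R : realType) (V W : normedModType R) (k : nat) (U : set V)
    (w : W) : Ck k U (cst w : V -> W).
Proof.
elim: k w => [|k IHk] w /=; first by move=> x _; exact: cvg_cst.
split=> // v.
by rewrite (_ : (fun x => _) = cst 0) //; apply/funext => x; exact: derive_cst.
Qed.

Lemma linear_continuous_rV (R : realType) (m : nat) (W : normedModType R)
    (f : {linear 'rV[R]_m -> W}) : continuous f.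
Proof.
move=> x; rewrite (_ : (f : _ -> _) =
    fun y => \sum_(j < m) y 0 j *: f (delta_mx 0 j)); last first.
  apply/funext => y; rewrite {1}(row_sum_delta y) linear_sum.
  by apply: eq_bigr => j _; rewrite linearZ.
have xF := nbhs_filter x.
apply: (@cvg_big _ _ _ _ _ _ _ (nbhs x)) => [|j _]; first exact: add_continuous.
apply: cvgZr_tmp; exact: coord_continuous.
Qed.

Lemma smooth_linear (R : realType) (m : nat) (W : normedModType R)
    (U : set 'rV[R]_m) (f : {linear 'rV[R]_m -> W}) : smooth U f.
Proof.
have cf := @linear_continuous_rV R m W f.
have df x : differentiable f x by exact: linear_differentiable.
case=> [|k] /=; first by move=> x _; exact: cf.
split=> // v; rewrite (_ : (fun x => _) = cst (f v)); first exact: Ck_cst.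
by apply/funext => x; rewrite deriveE // diff_lin.
Qed.

Lemma derive1_linear_comp (R : realType) (V W : normedModType R)
    (f : {linear V -> W}) (c : R -> V) (t : R) :
  continuous f -> differentiable c t -> derive1 (f \o c) t = f (derive1 c t).
Proof.
move=> cf dc; have df := linear_differentiable (c t) cf.
rewrite !derive1E deriveE; last exact: differentiable_comp.
have -> := diff_comp dc df.
by rewrite /comp (diff_lin _ cf) deriveE.
Qed.

Lemma differentiable_linear_comp (R : realType) (V W : normedModType R)
    (f : {linear V -> W}) (c : R -> V) (t : R) :
  continuous f -> differentiable c t -> differentiable (f \o c) t.
Proof.
move=> cf dc; apply: (differentiable_comp dc); exact: linear_differentiable.
Qed.

Lemma is_derive_coord (R : realType) (m : nat) (c : R -> 'rV[R]_m) (t : R) j :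
  differentiable c t -> is_derive t 1 (fun s => c s 0 j) (derive1 c t 0 j).
Proof.
move=> dc; have vc : derivable c t 1 by exact: diff_derivable.
apply: DeriveDef; first by have /derivable_mxP := vc; apply.
by rewrite derive1E derive_mx // mxE.
Qed.

(** Chain rule along a curve, in terms of partial derivatives. *)
Lemma is_derive_comp_rV (R : realType) (m : nat) (W : normedModType R)
    (f : 'rV[R]_m -> W) (c : R -> 'rV[R]_m) (t : R) :
  differentiable f (c t) -> differentiable c t ->
  is_derive t 1 (f \o c)
    (\sum_(j < m) derive1 c t 0 j *: 'D_(delta_mx 0 j) f (c t)).
Proof.
move=> df dc; have dfc : differentiable (f \o c) t.
  exact: differentiable_comp.
apply: DeriveDef; first exact: diff_derivable.
rewrite deriveE //; have -> := diff_comp dc df.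
have v : 'd c t 1 = derive1 c t by rewrite derive1E deriveE.
rewrite /comp v {1}(row_sum_delta (derive1 c t)) linear_sum.
by apply: eq_bigr => j _; rewrite linearZ deriveE.
Qed.

(** * Linear algebra *)

Lemma linear_cancelC (F : fieldType) (m : nat)
    (f h : {linear 'rV[F]_m -> 'rV[F]_m}) : cancel f h -> cancel h f.
Proof.
move=> fK y.
have : lin1_mx f *m lin1_mx h = 1%:M.
  by apply/row_matrixP => i; rewrite !rowE mulmxA !mul_rV_lin1 fK mulmx1.
by move/mulmx1C => hf; rewrite -!mul_rV_lin1 -mulmxA hf mulmx1.
Qed.

Section InnerProduct.
Variables (R : realType) (m : nat) (h : 'rV[R]_m -> 'rV[R]_m -> R).
Hypothesis hi : is_inner_product h.

Lemma inner_sym u v : h u v = h v u. Proof. by case: hi. Qed.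

Lemma innerDl u v w : h (u + v) w = h u w + h v w.
Proof. by have [/(_ 1 u v w)] := hi; rewrite scale1r mul1r. Qed.

Lemma inner0l w : h 0 w = 0.
Proof. by apply: (addrI (h 0 w)); rewrite -innerDl !addr0. Qed.

Lemma innerZl k u w : h (k *: u) w = k * h u w.
Proof. by have [/(_ k u 0 w)] := hi; rewrite inner0l !addr0. Qed.

Lemma innerZr k u w : h w (k *: u) = k * h w u.
Proof. by rewrite inner_sym innerZl inner_sym. Qed.

Lemma inner_suml (I : finType) (u : I -> 'rV[R]_m) w :
  h (\sum_k u k) w = \sum_k h (u k) w.
Proof.
apply: (big_morph (fun u => h u w)); last exact: inner0l.
by move=> ? ?; exact: innerDl.
Qed.

End InnerProduct.

(** * Coordinates of tangent vectors *)

Section TangentCoordinates.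
Variables (R : realType) (m : nat) (X : Type) (A : atlas R m X).
Hypothesis mA : is_manifold A.
Implicit Types (i : chart_idx A) (p : X) (u y : 'rV[R]_m).

Lemma open_chart_dom i : open (chart i @` dom i).
Proof. by have := @mopen_dom _ _ _ _ mA i i; rewrite setIid. Qed.

Lemma tvect_tcoord i p u :
  dom i p -> tvect i (chart i p) (tcoord i p u) = u.
Proof.
move=> ip; apply: linear_cancelC => y; exact: tcoord_tvect.
Qed.

Lemma diff_chart_param i p : dom i p ->
  'd (chart i \o param i) (chart i p) = id :> ('rV[R]_m -> 'rV[R]_m).
Proof.
move=> ip; have e : \forall x \near chart i p, id x = (chart i \o param i) x.
  have : nbhs (chart i p) (chart i @` dom i).
    by apply: open_nbhs_nbhs; split; [exact: open_chart_dom|exists p].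
  by apply: filterS => _ [q iq <-] /=; rewrite (chartK mA).
apply/funext => y; rewrite -deriveE.
  by rewrite -(near_eq_derive _ e) derive_id.
by apply: near_eq_differentiable e _; exact: ex_diff.
Qed.

Lemma tcoord_chart_at p u : tcoord (chart_at A p) p u = u.
Proof. by rewrite /tcoord diff_chart_param //; exact: dom_chart_at. Qed.

Lemma tvect_chart_at p y :
  tvect (chart_at A p) (chart (chart_at A p) p) y = y.
Proof.
by rewrite -[in LHS](tcoord_chart_at p y) tvect_tcoord //; exact: dom_chart_at.
Qed.

Lemma tcoordZ i p (k : R) u : tcoord i p (k *: u) = k *: tcoord i p u.
Proof. exact: linearZ. Qed.

End TangentCoordinates.

(** * The fibrewise homothety *)

Section FiberScaling.
Variables (R : realType) (n : nat) (X : Type) (M : atlas R n X).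
Local Notation TM := (tangent_atlas M).

(** The homothety of ratio [k] in each tangent space.  It preserves the base
    point, hence the chart in which components are taken. *)
Definition fiber_scale (k : R) (z : X * 'rV[R]_n) : X * 'rV[R]_n :=
  (z.1, k *: z.2).

(** The map (x, y) |-> (x, k y) as a linear map: what [fiber_scale k] becomes in
    the coordinates induced by any chart. *)
Definition fiber_scale_coord (k : R) :
    {linear 'rV[R]_(n + n) -> 'rV[R]_(n + n)} :=
  mulmxr (block_mx 1%:M 0 0 k%:M).

Lemma fiber_scale_coordE k w :
  fiber_scale_coord k w = row_mx (lsubmx w) (k *: rsubmx w).
Proof.
rewrite -[in LHS](hsubmxK w) /fiber_scale_coord /= mul_row_block.
by rewrite !mulmx0 mulmx1 addr0 add0r mul_mx_scalar.
Qed.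

Lemma chart_fiber_scale (i : chart_idx M) k z :
  chart (a := TM) i (fiber_scale k z) =
  fiber_scale_coord k (chart (a := TM) i z).
Proof. by rewrite fiber_scale_coordE /= row_mxKl row_mxKr tcoordZ. Qed.

(** No atlas axiom is needed: the coordinate expression of [fiber_scale] is
    exact on the whole of TM. *)
Lemma velocity_fiber_scale k (S : set (X * 'rV[R]_n)) z c :
  curve_in TM S z c ->
  velocity TM (fiber_scale k \o c) = fiber_scale_coord k (velocity TM c).
Proof.
move=> [c0 [e e0 [_ sc]]].
rewrite /velocity (_ : chart _ \o _ =
  fiber_scale_coord k \o (chart (chart_at TM (c 0)) \o c)); last first.
  by apply/funext => s; exact: chart_fiber_scale.
have dc : differentiable (chart (chart_at TM (c 0)) \o c) (0 : R).
  by rewrite c0; have [+ _] := sc 1%N; apply; rewrite /= normr0.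
exact: derive1_linear_comp (@linear_continuous_rV _ _ _ _) dc.
Qed.

Lemma fiber_scaleK k : k != 0 ->
  cancel (fiber_scale k) (fiber_scale k^-1).
Proof.
by move=> k0 [p u]; rewrite /fiber_scale /= scalerA mulVf // scale1r.
Qed.

Lemma gamma_fiber_scale g k z Y :
  gamma M g (fiber_scale k z) Y = k *: gamma M g z Y.
Proof.
apply/rowP => i; rewrite !mxE mulr_sumr; apply: eq_bigr => j _.
by rewrite mulr_sumr; apply: eq_bigr => l _; rewrite !mxE; ring.
Qed.

Lemma hpart_fiber_scale k z w :
  hpart (fiber_scale k z) (fiber_scale_coord k w) = hpart z w.
Proof. by rewrite fiber_scale_coordE /hpart row_mxKl. Qed.

Lemma vpart_fiber_scale g k z w :
  vpart M g (fiber_scale k z) (fiber_scale_coord k w) = k *: vpart M g z w.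
Proof.
rewrite fiber_scale_coordE /vpart row_mxKl row_mxKr gamma_fiber_scale.
by rewrite scalerDr.
Qed.

Hypothesis hM : is_manifold M.

Lemma mopenT_tangent : mopen TM setT.
Proof.
move=> i; rewrite setTI.
have -> : chart (a := TM) i @` dom i =
    lsubmx @^-1` (chart (a := M) i @` dom (a := M) i).
  apply/seteqP; split=> [_ [[p u] /= ip <-]|w [p ip pw]] /=.
    by exists p => //; rewrite row_mxKl.
  exists (p, tvect (A := M) i (chart (a := M) i p) (rsubmx w)) => //=.
  by rewrite (tcoord_tvect _ hM) // pw hsubmxK.
apply: open_comp; last exact: open_chart_dom.
by move=> ? _; exact: continuous_lsubmx.
Qed.

Lemma smooth_on_fiber_scale k (S : set (X * 'rV[R]_n)) :
  smooth_on TM TM S (fiber_scale k).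
Proof.
move=> z Sz; exists setT, (fiber_scale k); split=> //.
  exact: mopenT_tangent.
rewrite /smooth_near; set i := chart_at TM z.
rewrite (_ : chart_at TM (fiber_scale k z) = i) //.
have oU : open (chart (a := TM) i @` dom i).
  by have := @mopenT_tangent i; rewrite setTI.
have domP w : (chart (a := TM) i @` dom i) w ->
    exists2 q, dom (a := M) i q & chart (a := M) i q = lsubmx w.
  by move=> [[q u] iq <-]; exists q; rewrite //= row_mxKl.
exists (chart (a := TM) i @` dom i); split=> //.
- by exists z => //; exact: (dom_chart_at hM).
- by move=> w /domP[q iq /= <-]; rewrite (chartK hM).
apply: smooth_eq oU _ (@smooth_linear _ _ _ _ (fiber_scale_coord k)).
move=> w /domP[q iq qw]; rewrite /comp chart_fiber_scale.
rewrite -[LHS]/(fiber_scale_coord k w); apply: (congr1 (fiber_scale_coord k)).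
by rewrite /= -qw (chartK hM) // (tcoord_tvect _ hM) // qw hsubmxK.
Qed.

End FiberScaling.

(** * Vectors tangent to a sphere bundle *)

Section SphereBundleCurves.
Variables (R : realType) (n : nat) (X : Type) (M : atlas R n X).
Variable g : tensor2 R n X.
Hypotheses (hM : is_manifold M) (hg : is_riemannian_metric M g).
Local Notation TM := (tangent_atlas M).

Let gi p : is_inner_product (g p). Proof. by case: hg. Qed.

(** The matrix [gmat] expresses the metric in any chart around the point, not
    only in the preferred one. *)
Lemma metric_gmat (i : chart_idx M) p u v : dom i p ->
  g p u v = \sum_(k < n) \sum_(l < n)
    gmat g i (chart i p) k l * tcoord i p u 0 k * tcoord i p v 0 l.
Proof.
move=> ip.
have E w : w = \sum_k tcoord i p w 0 k *: tvect i (chart i p) (delta_mx 0 k).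
  rewrite -[LHS](tvect_tcoord hM w ip) {1}(row_sum_delta (tcoord i p w)).
  by rewrite /tvect linear_sum; apply: eq_bigr => k _; rewrite linearZ.
rewrite {1}(E u) (inner_suml (gi p)); apply: eq_bigr => k _.
rewrite (innerZl (gi p)) (inner_sym (gi p)) {1}(E v) (inner_suml (gi p)).
rewrite mulr_sumr; apply: eq_bigr => l _.
by rewrite (innerZl (gi p)) (inner_sym (gi p)) mxE (chartK hM) //; ring.
Qed.

(** Metric compatibility of the Levi-Civita connection, contracted: with [u]
    held fixed in coordinates, the derivative of g_kl u^k u^l along [xi] is
    2 g(gamma xi, u). *)
Lemma sum_partial_gmat p (xi u : 'rV[R]_n) (i := chart_at M p) :
  \sum_(k < n) \sum_(l < n)
    (\sum_(j < n) xi 0 j * partial_gmat g i (chart i p) j k l) *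
      u 0 k * u 0 l = 2 * g p (gamma M g (p, u) xi) u.
Proof.
have ip : dom i p := dom_chart_at hM p.
have [_ dg] := (christoffelP _ hM hg ip).2 (fun k j l => erefl).
set G := gmat g i (chart i p) in dg *.
set C := christoffel g i (chart i p) in dg.
have Gsym k l : G k l = G l k by rewrite !mxE (inner_sym (gi _)).
have gE : g p (gamma M g (p, u) xi) u =
    \sum_k \sum_l G k l * gamma M g (p, u) xi 0 k * u 0 l.
  by rewrite (metric_gmat _ _ ip) /i !(tcoord_chart_at hM).
(* [B k l] is the (k, l) term coming from Gamma^s_jk g_sl, contracted with [xi],
   [u] and [u]; the term coming from Gamma^s_jl g_ks is its transpose. *)
pose B k l := \sum_s (\sum_j C s j k * xi 0 j * u 0 k) * G s l * u 0 l.
have BE : \sum_k \sum_l B k l = g p (gamma M g (p, u) xi) u.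
  rewrite gE exchange_big [RHS]exchange_big /=; apply: eq_bigr => l _.
  rewrite exchange_big; apply: eq_bigr => s _; rewrite -!mulr_suml.
  rewrite [G s l * _]mulrC; congr (_ * _ * _).
  by rewrite exchange_big /gamma mxE.
rewrite mulr2n mulrDl mul1r -{1}BE -BE [X in _ + X]exchange_big -big_split /=.
apply: eq_bigr => k _; rewrite -big_split; apply: eq_bigr => l _.
rewrite /B -big_split /= 2!mulr_suml.
under [LHS]eq_bigr do rewrite dg mulr_sumr !mulr_suml.
rewrite exchange_big; apply: eq_bigr => s _.
rewrite !mulr_suml -big_split; apply: eq_bigr => j _ /=.
by rewrite (Gsym k s); ring.
Qed.

(** The vertical part of a vector tangent to a sphere bundle at (p, u) is
    orthogonal to u. *)
Lemma sphere_bundle_orth r z c :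
  curve_in TM (sphere_bundle g r) z c ->
  g z.1 (vpart M g z (velocity TM c)) z.2 = 0.
Proof.
move=> [c0 [e e0 [cS sc]]].
pose i := chart_at M z.1.
have ip : dom i z.1 := dom_chart_at hM z.1.
pose C := chart (a := TM) i \o c.
have dC : differentiable C (0 : R).
  by have [+ _] := sc 1%N; apply; rewrite /= normr0.
have vE : velocity TM c = derive1 C 0 by rewrite /velocity c0.
have C0 : C 0 = row_mx (chart i z.1) z.2.
  by rewrite /C /comp c0 /= tcoord_chart_at.
pose xi := lsubmx (velocity TM c); pose eta := rsubmx (velocity TM c).
have cl := @continuous_lsubmx R 1 n n; have cr := @continuous_rsubmx R 1 n n.
have dx : differentiable (lsubmx \o C) (0 : R).
  exact: (differentiable_linear_comp cl dC).
have x'E : derive1 (lsubmx \o C) 0 = xi.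
  by rewrite /xi vE; exact: (derive1_linear_comp cl dC).
have dy : differentiable (rsubmx \o C) (0 : R).
  exact: (differentiable_linear_comp cr dC).
have y'E : derive1 (rsubmx \o C) 0 = eta.
  by rewrite /eta vE; exact: (derive1_linear_comp cr dC).
have x0 : (lsubmx \o C) 0 = chart i z.1 by rewrite /comp C0 row_mxKl.
have y0 : (rsubmx \o C) 0 = z.2 by rewrite /comp C0 row_mxKr.
pose G := gmat g i (chart i z.1).
pose F k l := (fun x => gmat g i x k l) \o (lsubmx \o C).
pose y j s := (rsubmx \o C) s 0 j.
pose dG k l := \sum_j xi 0 j * partial_gmat g i (chart i z.1) j k l.
have dF k l : is_derive (0 : R) 1 (F k l) (dG k l).
  have := @is_derive_comp_rV _ _ _ (fun x => gmat g i x k l) _ 0 _ dx.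
  rewrite x0 x'E; apply.
  by have [+ _] := hg.2 i k l 1%N; apply; exists z.1.
have dyj j : is_derive (0 : R) 1 (y j) (eta 0 j).
  by rewrite -y'E; exact: is_derive_coord.
pose dN k l := G k l * z.2 0 k * eta 0 l + G k l * eta 0 k * z.2 0 l
               + dG k l * z.2 0 k * z.2 0 l.
have dFyy k l : is_derive (0 : R) 1 (F k l * y k * y l) (dN k l).
  apply: is_derive_eq.
  have F0 : F k l 0 = G k l by rewrite /F /= C0 row_mxKl.
  have yE j : y j 0 = z.2 0 j by rewrite /y y0.
  rewrite -[(F k l * y k) 0]/(F k l 0 * y k 0) F0 !yE /dN.
  rewrite -[LHS]/(G k l * z.2 0 k * eta 0 l +
    z.2 0 l * (G k l * eta 0 k + z.2 0 k * dG k l)).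
  by ring.
(* The squared norm along [c] is constant, so its derivative, computed by the
   product rule, vanishes. *)
have DN := is_derive_sum (fun k => is_derive_sum (dFyy k)).
have Ncst : \forall s \near (0 : R),
    (\sum_k \sum_l F k l * y k * y l) s = cst (r ^+ 2) s.
  have : \forall s \near (0 : R), `|s| < e by exact: nbhs0_lt.
  apply: filterS => s /cS [sS sd].
  rewrite -[RHS]sS (metric_gmat _ _ sd) fct_sumE; apply: eq_bigr => k _.
  rewrite fct_sumE; apply: eq_bigr => l _.
  by rewrite /F /y /C !fctE /= row_mxKl row_mxKr.
have := @derive_val _ _ _ _ _ _ _ (near_eq_is_derive Ncst DN).
have gE Y Z : g z.1 Y Z = \sum_k \sum_l G k l * Y 0 k * Z 0 l.
  by rewrite (metric_gmat _ _ ip) /i !(tcoord_chart_at hM).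
have -> : \sum_k \sum_l dN k l = 2 * g z.1 (vpart M g z (velocity TM c)) z.2.
  under eq_bigr do rewrite !big_split /=.
  rewrite !big_split /= -!gE (sum_partial_gmat z.1 xi z.2) (inner_sym (gi _)).
  by rewrite /vpart (innerDl (gi _)) -surjective_pairing; ring.
by rewrite derive_cst => /esym/eqP; rewrite mulf_eq0 pnatr_eq0 => /eqP.
Qed.
End SphereBundleCurves.

(** * The isometry *)

Theorem theorem3p3 (R : realType) (n : nat) (X : Type) (M : atlas R n X)
    (g : tensor2 R n X) (a b : R -> R)
    (hM : is_manifold M) (hg : is_riemannian_metric M g)
    (ha : smooth_half_line a) (hb : smooth_half_line b)
    (a_gt0 : forall t, 0 <= t -> 0 < a t)
    (b_ge0 : forall t, 0 <= t -> 0 <= b t) :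
  forall r : R, r = Num.sqrt (a 2^-1) ->
  isometric (tangent_atlas M) (sphere_bundle g 1) (metricA M g a b)
            (tangent_atlas M) (sphere_bundle g r) (metricS M g).
Proof.
move=> r rE.
have a0 : 0 < a 2^-1 by apply: a_gt0; rewrite invr_ge0 ler0n.
have r0 : r != 0 by rewrite rE gt_eqF // sqrtr_gt0.
have r2 : r ^+ 2 = a 2^-1 by rewrite rE sqr_sqrtr // ltW.
have gi p : is_inner_product (g p) by case: hg.
have gZZ p k u v : g p (k *: u) (k *: v) = k ^+ 2 * g p u v.
  by rewrite (innerZl (gi p)) (innerZr (gi p)) mulrA -expr2.
have rK := @fiber_scaleK R n X r r0.
exists (fiber_scale r); split.
- split.
  + by move=> z; rewrite /sphere_bundle /= gZZ => ->; rewrite expr1n mulr1.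
  + by move=> z z' _ _ /(congr1 (fiber_scale r^-1)); rewrite !rK.
  + move=> z; rewrite /sphere_bundle /= => zr; exists (fiber_scale r^-1 z).
      by rewrite /= gZZ zr -exprMn mulVf.
    by have := @fiber_scaleK R n X r^-1; rewrite invr_eq0 invrK; apply.
- exact: smooth_on_fiber_scale.
- exists (fiber_scale r^-1); first by move=> z _; exact: rK.
  exact: smooth_on_fiber_scale.
move=> z c1 c2 zS c1S c2S.
rewrite (velocity_fiber_scale _ c1S) (velocity_fiber_scale _ c2S).
rewrite /metricS /metricA !hpart_fiber_scale !vpart_fiber_scale gZZ.
(* The factor g(V1, u) = 0 kills the term in [b], one curve being enough. *)
rewrite (sphere_bundle_orth hM hg c1S) [g z.1 z.2 z.2]zS r2 expr1n mulr1.
by rewrite !mulr0 !mul0r !addr0 mul1r.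
Qed.
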